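(* Let $M$ and $N$ be oriented, $n$-dimensional (smooth) manifolds with volume forms $\mu_M$ and $\mu_N$, respectively, and let $\varphi\colon M\to N$ be an orientation-preserving diffeomorphism with Jacobian determinant $J(\mu_M,\mu_N)\varphi\in C^\infty(M)$. Then, for any function $u\in C^\infty(M)$ with compact support $\operatorname{supp}u$, $$\bigl\lVert \mathbf{1}_{\operatorname{supp}u}\,[J(\mu_M,\mu_N)\varphi]^{-1/p}\bigr\rVert_\infty^{-1}\,\lVert u\rVert_p\;\le\;\lVert u\circ\varphi^{-1}\rVert_p\;\le\;\bigl\lVert \mathbf{1}_{\operatorname{supp}u}\,[J(\mu_M,\mu_N)\varphi]^{1/p}\bigr\rVert_\infty\,\lVert u\rVert_p$$ for all $p\in[1,\infty]$.
   Context: A volume form on an oriented $n$-manifold is a smooth $n$-form that is everywhere positive with respect to the orientation. The Jacobian determinant $J(\mu_M,\mu_N)\varphi\in C^\infty(M)$ is the (positive) function determined by $\varphi^*\mu_N=[J(\mu_M,\mu_N)\varphi]\,\mu_M$. Functions are real-valued. $\lVert\cdot\rVert_p$ denotes the $L^p$-norm with respect to the measure given by $\mu_M$ (for functions on $M$) or $\mu_N$ (for functions on $N$), i.e. $\lVert u\rVert_p=\bigl(\int_M|u|^p\mu_M\bigr)^{1/p}$ for $p<\infty$ and the essential supremum for $p=\infty$. $\mathbf{1}_S$ is the indicator function of $S$. Convention: $1/\infty=0$. In the degenerate case $u=0$, the left-hand side is read as $0$. *)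

(* Defs.v *)
From HB Require Import structures.
From mathcomp Require Import all_boot all_order all_algebra.
From mathcomp Require Import all_classical all_reals all_analysis.
From mathcomp Require Import measurable_realfun.

Set Implicit Arguments.
Unset Strict Implicit.
Unset Printing Implicit Defensive.

Import Order.TTheory GRing.Theory Num.Theory.
Import numFieldNormedType.Exports.

Local Open Scope classical_set_scope.
Local Open Scope ring_scope.

Notation borel T := (g_sigma_algebraType (@open T)).

Lemma open_borel (T : ptopologicalType) (A : set T) :
  open A -> measurable (A : set (borel T)).
Proof. exact: sub_sigma_algebra. Qed.

Lemma continuous_borel_fun (S T : ptopologicalType) (D : set S) (f : S -> T) :
  open D -> (forall x, D x -> {for x, continuous f}) ->
  measurable_fun (D : set (borel S)) (f : borel S -> borel T).
Proof.
move=> oD cf; apply: (@measurability _ _ (borel S) (borel T) D f (@open T)) => //.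
move=> _ [U oU <-]; apply: open_borel.
rewrite openE => x [Dx Ufx]; apply: filterI.
  by apply: open_nbhs_nbhs.
by apply: (cf x Dx); apply: open_nbhs_nbhs.
Qed.

Lemma continuous_borel_real (R : realType) (S : ptopologicalType) (D : set S)
    (f : S -> R) :
  open D -> (forall x, D x -> {for x, continuous f}) ->
  measurable_fun (D : set (borel S)) (f : borel S -> R).
Proof.
move=> oD cf.
apply: (measurability _ (RGenOpens.measurableE R)).
move=> _ [_ [a [b ->]] <-]; apply: open_borel.
rewrite openE => x [Dx Ufx]; apply: filterI.
  by apply: open_nbhs_nbhs.
by apply: (cf x Dx); apply: open_nbhs_nbhs; split => //; exact: interval_open.
Qed.

Section Lebesgue.
Context {R : realType}.

Definition image_measure d d' (T1 : measurableType d) (T2 : measurableType d')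
    (m : {measure set T1 -> \bar R}) (f : T1 -> T2)
    (mf : measurable_fun setT f) : {measure set T2 -> \bar R} :=
  measure_function_pushforward__canonical__measure_function_Measure m mf.

Lemma measurable_tuple_cons n :
  measurable_fun setT
    (fun z : n.-tuple R * R => [tuple of z.2 :: z.1] : n.+1.-tuple R).
Proof. by apply: measurable_cons. Qed.

Fixpoint lebesgue_tuple n : {measure set (n.-tuple R) -> \bar R} :=
  match n with
  | 0 => \d_[tuple]
  | n'.+1 => image_measure (lebesgue_tuple n' \x (@lebesgue_measure R))%E
               (@measurable_tuple_cons n')
  end.

Let row_of n (t : n.-tuple R) : 'rV[R]_n := \row_i tnth t i.

Lemma measurable_row_of n :
  measurable_fun setT (@row_of n : n.-tuple R -> borel 'rV[R]_n).
Proof.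
apply: (@measurability _ _ _ (borel 'rV[R]_n) setT _ (@open 'rV[R]_n)) => //.
move=> _ [U oU <-]; rewrite setTI.
pose B (a : n.-tuple rat * nat) : set 'rV[R]_n :=
  ball (row_of (map_tuple ratr a.1)) a.2.+1%:R^-1.
have -> : row_of (n:=n) @^-1` U =
    \bigcup_(a in [set a | B a `<=` U]) (row_of (n:=n) @^-1` (B a)).
  apply/seteqP; split => [t Ut|t [a aU Bt]]; last exact: aU.
  have /nbhs_ballP[e /= e0 eU] : nbhs (row_of t) U by apply: open_nbhs_nbhs.
  have [k ke] : exists k : nat, k.+1%:R^-1 < e / 2.
    have : 0 < e / 2 by rewrite divr_gt0.
    by move/ltr_add_invr => [k]; rewrite add0r => ?; exists k.
  have q_ i : {q : rat | `|ratr q - tnth t i| < k.+1%:R^-1}.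
    have k0 : (0 : R) < k.+1%:R^-1 by rewrite invr_gt0.
    have I0 : `]tnth t i - k.+1%:R^-1, tnth t i + k.+1%:R^-1[%classic !=set0.
      by exists (tnth t i); rewrite /= in_itv/= ltrBlDr ltrDl k0.
    have Io : open `]tnth t i - k.+1%:R^-1, tnth t i + k.+1%:R^-1[%classic.
      exact: interval_open.
    apply: cid; have [r [+ [q _ qr]]] := dense_rat I0 Io.
    by rewrite -qr /= in_itv/= => qt; exists q; rewrite ltr_distl.
  pose q := [tuple sval (q_ i) | i < n].
  have Bq : B (q, k) (row_of t).
    split=> [|i j]; first by rewrite invr_gt0.
    rewrite !mxE tnth_map tnth_mktuple.
    by rewrite -ball_normE /ball_/=; case: (q_ j).
  exists (q, k) => //= v Bv; apply: eU.
  apply: (@le_ball _ _ _ (k.+1%:R^-1 + k.+1%:R^-1)).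
    by rewrite [leRHS]splitr lerD// ltW.
  by apply: ball_triangle Bv; exact: ball_sym.
rewrite bigcup_mkcond; apply: countable_bigcupT_measurable => // a.
case: ifPn => // _.
case: (pselect (0 < a.2.+1%:R^-1 :> R)) => [a0|]; last by rewrite invr_gt0 ltr0n.
have -> : row_of (n:=n) @^-1` B a =
    \big[setI/setT]_(i < n) ((fun t => tnth t i) @^-1`
       ball (ratr (tnth a.1 i) : R) a.2.+1%:R^-1).
  rewrite -bigcap_seq; apply/seteqP; split => [t [_ Bt] i _|t Bt].
    by have := Bt ord0 i; rewrite !mxE tnth_map.
  split=> // i j; rewrite !mxE tnth_map; apply: (Bt j) => /=.
  exact: mem_index_enum.
apply: bigsetI_measurable => i _; rewrite -[X in measurable X]setTI.
apply: measurable_tnth => //.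
by apply: open_measurable; apply: ball_open.
Qed.

(* Iterated product measure, transported along 'rV[R]_n = R^n. *)
Definition lebesgue_rV n : {measure set (borel 'rV[R]_n) -> \bar R} :=
  image_measure (lebesgue_tuple n) (@measurable_row_of n).

End Lebesgue.
Section Smooth.
Context {R : realType}.

Fixpoint Ck m (W : normedModType R) (U : set 'rV[R]_m) (k : nat)
    (f : 'rV[R]_m -> W) : Prop :=
  (forall x, U x -> {for x, continuous f}) /\
  match k with
  | 0 => True
  | k'.+1 => forall i : 'I_m,
      (forall x, U x -> derivable f x (delta_mx 0 i)) /\
      Ck U k' ('D_(delta_mx 0 i) f)
  end.

Definition smooth_on m (W : normedModType R) (U : set 'rV[R]_m)
  (f : 'rV[R]_m -> W) : Prop := forall k, Ck U k f.

End Smooth.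

(* The values of a chart (resp. of its inverse) outside its domain (resp. its
   codomain) are junk. *)
Record chart (R : realType) (n : nat) (M : topologicalType) := Chart {
  chart_dom : set M;
  chart_cod : set 'rV[R]_n;
  chart_map :> M -> 'rV[R]_n;
  chart_inv : 'rV[R]_n -> M;
  chart_dom_open : open chart_dom;
  chart_cod_open : open chart_cod;
  chart_map_cod : forall p, chart_dom p -> chart_cod (chart_map p);
  chart_inv_dom : forall y, chart_cod y -> chart_dom (chart_inv y);
  chart_mapK : forall p, chart_dom p -> chart_inv (chart_map p) = p;
  chart_invK : forall y, chart_cod y -> chart_map (chart_inv y) = y;
  chart_map_continuous :
    forall p, chart_dom p -> {for p, continuous chart_map};
  chart_inv_continuous :
    forall y, chart_cod y -> {for y, continuous chart_inv} }.

Arguments chart_dom_open {R n M} c.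
Arguments chart_cod_open {R n M} c.
Arguments chart_map_cod {R n M} c [p].
Arguments chart_inv_dom {R n M} c [y].
Arguments chart_mapK {R n M} c [p].
Arguments chart_invK {R n M} c [y].
Arguments chart_map_continuous {R n M} c [p].
Arguments chart_inv_continuous {R n M} c [y].

Definition smooth_transition (R : realType) n (M : topologicalType)
    (c d : chart R n M) : Prop :=
  smooth_on (chart_cod c `&` chart_inv c @^-1` chart_dom d)
    (d \o chart_inv c).

(* The atlas is maximal. The carrier is pointed because measurable types are;
   this only excludes the empty manifold. *)
Record smooth_manifold (R : realType) (n : nat) := SmoothManifold {
  carrier :> ptopologicalType;
  manifold_hausdorff : hausdorff_space carrier;
  manifold_second_countable : @second_countable carrier;
  atlas : set (chart R n carrier);
  atlas_cover : forall p, exists2 c, atlas c & chart_dom c p;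
  atlas_smooth : forall c d, atlas c -> atlas d -> smooth_transition c d;
  atlas_maximal : forall c,
    (forall d, atlas d -> smooth_transition c d /\ smooth_transition d c) ->
    atlas c }.

Section Manifold.
Context {R : realType} {n : nat}.
Implicit Types M N : smooth_manifold R n.

Definition smooth_fun M (u : M -> R) : Prop :=
  forall c, atlas c -> smooth_on (chart_cod c) (u \o chart_inv c).

Definition smooth_map M N (phi : M -> N) : Prop :=
  continuous phi /\
  forall c d, atlas c -> atlas d ->
    smooth_on (chart_cod c `&` chart_inv c @^-1` (phi @^-1` chart_dom d))
      (d \o phi \o chart_inv c).

Definition diffeomorphism M N (phi : M -> N) (psi : N -> M) : Prop :=
  [/\ smooth_map phi, smooth_map psi, cancel phi psi & cancel psi phi].

(* Determinant of the derivative of phi at p, in the charts c and d. *)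
Definition chart_det M N (phi : M -> N) (c : chart R n M) (d : chart R n N)
    (p : M) : R :=
  \det ('J (d \o phi \o chart_inv c) (c p)).

(* A continuous choice of orientations of the tangent spaces: [orient c p]
   tells whether the coordinate frame of the chart c is positive at p. *)
Record orientation M := Orientation {
  orient :> chart R n M -> M -> bool;
  orient_transition : forall c d p, atlas c -> atlas d ->
    chart_dom c p -> chart_dom d p ->
    orient d p = (orient c p == (0 < chart_det id c d p));
  orient_continuous : forall c p, atlas c -> chart_dom c p ->
    \forall q \near p, orient c q = orient c p }.

Definition orientation_preserving M N (oM : orientation M) (oN : orientation N)
    (phi : M -> N) : Prop :=
  forall c d p, atlas c -> atlas d -> chart_dom c p -> chart_dom d (phi p) ->
    oN d (phi p) = (oM c p == (0 < chart_det phi c d p)).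

(* A smooth form of degree n, given by its coefficients: in the chart
   c = (x_1, ..., x_n) it is [form_coef c] dx_1 /\ ... /\ dx_n. *)
Record top_form M := TopForm {
  form_coef :> chart R n M -> M -> R;
  form_transition : forall c d p, atlas c -> atlas d ->
    chart_dom c p -> chart_dom d p ->
    form_coef c p = form_coef d p * chart_det id c d p;
  form_smooth : forall c, atlas c ->
    smooth_on (chart_cod c) (form_coef c \o chart_inv c) }.

Definition is_volume_form M (o : orientation M) (w : top_form M) : Prop :=
  forall c p, atlas c -> chart_dom c p ->
    if o c p then 0 < w c p else w c p < 0.

(* phi^* muN = J muM, in all charts. *)
Definition is_jacobian_determinant M N (muM : top_form M) (muN : top_form N)
    (phi : M -> N) (J : M -> R) : Prop :=
  smooth_fun J /\
  forall c d p, atlas c -> atlas d -> chart_dom c p -> chart_dom d (phi p) ->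
    muN d (phi p) * chart_det phi c d p = J p * muM c p.

Definition supp M (u : M -> R) : set M := closure [set p | u p != 0].

End Manifold.

Section VolumeMeasure.
Context {R : realType} {n : nat} (M : smooth_manifold R n) (w : top_form M).
Local Open Scope ereal_scope.

Definition chart_volume (c : chart R n M) (A : set M) : \bar R :=
  \int[lebesgue_rV n]_(y in c @` A) (`|w c (chart_inv c y)|)%:E.

Definition local_volume (A : set (borel M)) : \bar R :=
  ereal_inf [set chart_volume c A | c in [set c | atlas c /\ A `<=` chart_dom c]].

(* The infimum of \sum_k local_volume (A k) over the countable covers of the
   argument by Borel sets A k; by [volume_unique] it coincides with any Borel
   measure that is given by [chart_volume c] on the domain of every chart c,
   i.e. with the measure A |-> \int_A |w|. *)
Definition volume : set (borel M) -> \bar R := mu_ext local_volume.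

Lemma chart_image (c : chart R n M) (A : set M) : A `<=` chart_dom c ->
  c @` A = chart_cod c `&` chart_inv c @^-1` A.
Proof.
move=> Ac; apply/seteqP; split => [_ [p Ap <-]|y [cy Ay]].
  split; first exact/chart_map_cod/Ac.
  by rewrite /preimage/= chart_mapK//; exact: Ac.
by exists (chart_inv c y) => //; rewrite chart_invK.
Qed.

Lemma measurable_chart_image (c : chart R n M) (A : set (borel M)) :
  measurable A -> A `<=` chart_dom c ->
  measurable (c @` A : set (borel 'rV[R]_n)).
Proof.
move=> mA Ac; rewrite chart_image//.
apply: (@continuous_borel_fun _ _ (chart_cod c) (chart_inv c)) => //.
- exact: (chart_cod_open c).
- by move=> y; exact: (@chart_inv_continuous _ _ _ c).
- exact: open_borel (chart_cod_open c).
Qed.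

Lemma measurable_chart_density (c : chart R n M) : atlas c ->
  measurable_fun (chart_cod c : set (borel 'rV[R]_n))
    (fun y => (`|w c (chart_inv c y)|)%:E).
Proof.
move=> ac; apply/measurable_EFinP; apply: measurableT_comp => //.
apply: (@continuous_borel_real _ _ (chart_cod c) (w c \o chart_inv c)).
  exact: (chart_cod_open c).
have [h _] := form_smooth w ac 0%N; exact h.
Qed.

Lemma chart_volumeU (c : chart R n M) (A B : set (borel M)) : atlas c ->
  measurable A -> measurable B -> A `|` B `<=` chart_dom c ->
  [disjoint A & B] -> chart_volume c (A `|` B) = chart_volume c A + chart_volume c B.
Proof.
move=> ac mA mB; rewrite subUset => -[Ac Bc] AB; rewrite /chart_volume image_setU.
apply: ge0_integral_setU => //.
- exact: measurable_chart_image.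
- exact: measurable_chart_image.
- apply: measurable_funS (measurable_chart_density ac).
  + exact: open_borel (chart_cod_open c).
  + by rewrite -image_setU => _ [p ABp <-]; apply: chart_map_cod; case: ABp => [/Ac|/Bc].
- apply/disj_setPS => y [[p Ap <-] [q Bq]] cqp.
  have pq : p = q.
    by rewrite -(chart_mapK c (Ac _ Ap)) -(chart_mapK c (Bc _ Bq)) cqp.
  by move/disj_setPS : AB => /(_ p); apply; split => //; rewrite pq.
Qed.

Lemma chart_volume_ge0 (c : chart R n M) A : 0 <= chart_volume c A.
Proof. by apply: integral_ge0 => y _; rewrite lee_fin. Qed.

Lemma local_volume_ge0 A : 0 <= local_volume A.
Proof. by apply: le_ereal_inf_tmp => _ [c _ <-]; exact: chart_volume_ge0. Qed.

Lemma local_volume0 : local_volume set0 = 0.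
Proof.
apply/eqP; rewrite eq_le local_volume_ge0 andbT; apply: ereal_inf_lbound.
have [c ac _] := atlas_cover (point : M).
exists c; first by split => //; exact: sub0set.
by rewrite /chart_volume image_set0 integral_set0.
Qed.

Lemma local_volumeID (A B : set (borel M)) : measurable A -> measurable B ->
  local_volume (A `&` B) + local_volume (A `&` ~` B) <= local_volume A.
Proof.
move=> mA mB; apply: le_ereal_inf_tmp => _ [c [ac Ac] <-].
have -> : chart_volume c A =
    chart_volume c (A `&` B) + chart_volume c (A `&` ~` B).
  rewrite -chart_volumeU//.
  - by rewrite -setIUr setUCr setIT.
  - exact: measurableI.
  - by apply: measurableI => //; exact: measurableC.
  - by rewrite -setIUr setUCr setIT.
  - by apply/disj_setPS => p [[_ Bp] [_]].
by apply: leeD; apply: ereal_inf_lbound; exists c => //; split=> // p [/Ac].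
Qed.

HB.instance Definition _ := isOuterMeasure.Build R (borel M) volume
  (mu_ext0 local_volume0 local_volume_ge0) (mu_ext_ge0 local_volume_ge0)
  (le_mu_ext local_volume) (mu_ext_sigma_subadditive local_volume_ge0).

Lemma borel_caratheodory (B : set (borel M)) :
  measurable B -> volume.-caratheodory B.
Proof.
move=> mB; apply: le_caratheodory_measurable => X.
apply: le_ereal_inf_tmp => _ [F [mF XF] <-].
apply: (@le_trans _ _ (\sum_(k <oo) local_volume (F k `&` B) +
                       \sum_(k <oo) local_volume (F k `&` ~` B))).
  apply: leeD; apply: ereal_inf_lbound.
    exists (fun k => F k `&` B) => //; split=> [k|]; first exact: measurableI.
    by rewrite -setI_bigcupl; exact: setISS.
  exists (fun k => F k `&` ~` B) => //; split=> [k|].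
    by apply: measurableI => //; exact: measurableC.
  by rewrite -setI_bigcupl; exact: setISS.
rewrite -nneseriesD; [|by move=> *; exact: local_volume_ge0..].
apply: lee_nneseries => [k *|k _].
  by apply: adde_ge0; exact: local_volume_ge0.
have h := local_volumeID (mF k) mB; exact: h.
Qed.

Let volume_sigma_additive : semi_sigma_additive volume.
Proof.
move=> F mF tF mUF; apply: caratheodory_measure_sigma_additive => //.
- by move=> i; exact: borel_caratheodory.
- exact: borel_caratheodory.
Qed.

HB.instance Definition _ := isMeasure.Build _ (borel M) R volume
  (mu_ext0 local_volume0 local_volume_ge0) (mu_ext_ge0 local_volume_ge0)
  volume_sigma_additive.

Lemma countable_atlas : exists c : nat -> chart R n M,
  (forall k, atlas (c k)) /\ \bigcup_k chart_dom (c k) = setT.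
Proof.
have [c0 ac0 _] := atlas_cover (point : M).
have [B /countable_injP[f fB] [Bo Bn]] := manifold_second_countable M.
pose P k (c : chart R n M) :=
  atlas c /\ forall b, B b -> f b = k ->
    (exists2 d : chart R n M, atlas d & b `<=` chart_dom d) ->
    b `<=` chart_dom c.
have /choice[c Pc] : forall k, exists c, P k c.
  move=> k; have [[b [Bb fb [d ad bd]]]|h] := pselect (exists b,
      [/\ B b, f b = k & exists2 d : chart R n M, atlas d & b `<=` chart_dom d]).
    exists d; split => // b' Bb' fb' _.
    by have -> : b' = b by apply: fB; rewrite ?inE// fb fb'.
  by exists c0; split => // b Bb fb bd; exfalso; apply: h; exists b.
exists c; split=> [k|]; first exact: (Pc k).1.
apply/seteqP; split=> // p _.
have [d ad dp] := atlas_cover p.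
have [|b [Bb bp] bd] := Bn p (chart_dom d).
  by apply: open_nbhs_nbhs; split => //; exact: (chart_dom_open d).
exists (f b) => //.
by apply: (proj2 (Pc (f b)) b) => //; exists d.
Qed.

Lemma volume_unique (nu : {measure set (borel M) -> \bar R}) :
  (forall (c : chart R n M) (A : set (borel M)),
    atlas c -> measurable A -> A `<=` chart_dom c ->
    nu A = chart_volume c A) ->
  forall A : set (borel M), measurable A -> volume A = nu A.
Proof.
move=> nuE A mA; apply/eqP; rewrite eq_le; apply/andP; split.
  have [c [ac cT]] := countable_atlas.
  pose D k : set (borel M) := chart_dom (c k).
  have mD k : measurable (D k) by exact: open_borel (chart_dom_open (c k)).
  pose F k : set (borel M) := A `&` seqDU D k.
  have mF k : measurable (F k).
    by apply: measurableI => //; exact: seqDU_measurable.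
  have UF : \bigcup_k F k = A.
    by rewrite -setI_bigcupr -seqDU_bigcup_eq [X in _ `&` X]cT setIT.
  have Fc k : F k `<=` chart_dom (c k) by move=> p [_ h]; exact: (subset_seqDU h).
  apply: (@le_trans _ _ (\sum_(k <oo) local_volume (F k))).
    apply: ereal_inf_lbound; exists F => //; split => //.
    by rewrite UF.
  apply: (@le_trans _ _ (\sum_(k <oo) nu (F k))).
    apply: lee_nneseries => [k *|k _]; first exact: local_volume_ge0.
    apply: ereal_inf_lbound; exists (c k); first by split; [exact: ac|exact: Fc].
    by rewrite (nuE (c k)).
  rewrite -[in leRHS]UF measure_bigcup//; last first.
    by apply: trivIset_setIl; exact: trivIset_seqDU.
  by rewrite [leRHS](@eq_eseriesl _ _ xpredT)// => k; rewrite in_setT.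
apply: le_ereal_inf_tmp => _ [F [mF AF] <-].
apply: (le_trans (measure_sigma_subadditive nu mF mA AF)).
apply: lee_nneseries => [k *|k _]; first exact: measure_ge0.
by apply: le_ereal_inf_tmp => _ [c [ac Fc] <-]; rewrite (nuE c).
Qed.

End VolumeMeasure.

Definition Lp_norm (R : realType) n (M : smooth_manifold R n) (w : top_form M)
    (p : \bar R) (u : M -> R) : \bar R :=
  'N[volume w : {measure set (borel M) -> \bar R}]_p[EFin \o u]%E.

(* Main.v *)
Require Import Defs.
From mathcomp Require Import all_boot all_order all_algebra.
From mathcomp Require Import all_classical all_reals all_analysis.
From mathcomp Require Import ess_sup_inf hoelder measurable_realfun.

(** The substitution formula says that the measure of [muN], pulled back along
    [phi], has density [J] with respect to the measure of [muM]. Only two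
    inequalities are extracted from it, one for each estimate: on a Borel set
    [A] where [J <= b], the pulled-back measure of [A] is at most [b] times its
    measure for [muM]; and symmetrically with the two measures exchanged and
    [J^-1] in place of [J] ([density_bound_volume] and
    [density_bound_volume_inv]).

    These inequalities do not depend on the change of variables formula of
    Lebesgue measure. Since [phi] is a diffeomorphism and atlases are maximal,
    composing a chart [c] of [M] with the inverse of [phi] gives a chart [d] of
    [N] ([atlas_transport_chart]). Read in [c] and [d], [phi] is the identity,
    its determinant is 1, and the defining equation of [J] says that the
    coefficient of [muN] in [d] is [J] times the coefficient of [muM] in [c]. So
    both volumes are integrals over the same subset of R^n, of densities that
    differ by the factor [J]; this comparison passes to the infimum over charts
    and covers that defines the volume ([volume_transport]).

    The rest is about two measures mu and nu on one space with
    [nu A <= b * mu A] whenever [J <= b] on [A] ([density_bound]). Such a nu is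
    absolutely continuous with respect to mu, so a bound
    [1_S * J `^ (1 / p) <= K] that holds mu-almost everywhere bounds [J] by
    [K `^ p] almost everywhere on [S] for both measures, and integrating
    [`|f| `^ p] for [f] supported in [S] gives [density_bound_Lnorm]. The upper
    estimate is this lemma for [J]; the lower one is this lemma for [J^-1] with
    the measures exchanged, followed by a division. *)

Set Implicit Arguments.
Unset Strict Implicit.
Unset Printing Implicit Defensive.

Import Order.TTheory GRing.Theory Num.Theory.
Import numFieldNormedType.Exports.

Local Open Scope classical_set_scope.
Local Open Scope ring_scope.

(** * Measures with a bounded relative density *)

Section Measures.
Context d (T : measurableType d) (R : realType).
Implicit Types (mu nu : {measure set T -> \bar R}) (J : T -> R).
Local Open Scope ereal_scope.
Import HBNNSimple.

(** On a nonnegative simple function below [f], every level set of a nonzero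
    value is contained in [E], so comparing the measures inside [E] is enough. *)
Lemma ge0_le_measure_integral_on mu nu (E : set T) (f : T -> \bar R) :
  (forall A, measurable A -> A `<=` E -> nu A <= mu A) ->
  (forall x, 0 <= f x) -> (forall x, ~ E x -> f x = 0) ->
  \int[nu]_x f x <= \int[mu]_x f x.
Proof.
move=> numu f0 fE; rewrite !ge0_integralTE//.
apply: ge_ereal_sup => _ [h/= hf <-].
apply: (@le_trans _ _ (sintegral mu h)); last by apply: ereal_sup_ubound; exists h.
rewrite !sintegralE lee_fsum// => r [t _ <-].
have [->|ht0] := eqVneq (h t) 0%R; first by rewrite !mul0e.
apply: lee_wpmul2l; first by rewrite lee_fin.
apply: numu => // x /= hx.
apply: contrapT => Ex; have := hf x; rewrite (fE _ Ex) hx lee_fin => ht.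
by move/eqP : ht0; apply; apply/eqP; rewrite eq_le ht/=.
Qed.

(** The inequality d nu <= J d mu between measures, stated without integrals:
    the volume of a form is only defined as an infimum over charts and covers,
    and in that shape it can be compared directly on sets where [J] is
    bounded by a constant. *)
Definition density_bound mu nu J := forall (A : set T) (b : R),
  measurable A -> (0 <= b)%R -> (forall x, A x -> (J x <= b)%R) ->
  nu A <= b%:E * mu A.

(** [A] is the countable union of its parts where [J <= k], and the
    [nu]-measure of each part is at most [k * 0]. *)
Lemma density_bound_null mu nu J (A : set T) : measurable_fun setT J ->
  density_bound mu nu J -> measurable A -> mu A = 0 -> nu A = 0.
Proof.
move=> mJ numu mA A0.
pose B k := A `&` (J @^-1` `]-oo, k%:R]%classic).
have mB k : measurable (B k).
  by apply: measurableI => //; rewrite -[X in measurable X]setTI; exact: mJ.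
have AB : A `<=` \bigcup_k B k.
  move=> x Ax; exists (Num.Def.archi_bound `|J x|%R) => //; split => //=.
  rewrite in_itv/= ltW//; apply: le_lt_trans (ler_norm _) _.
  exact: archi_boundP (normr_ge0 _).
apply/eqP; rewrite -measure_le0.
apply: le_trans (measure_sigma_subadditive nu mB mA AB) _.
rewrite eseries0// => k _ _.
apply/eqP; rewrite -measure_le0.
have Bk x : B k x -> (J x <= k%:R)%R by case=> _; rewrite /= in_itv.
apply: le_trans (numu _ _ (mB k) (ler0n _ k) Bk) _.
have -> : mu (B k) = 0.
  by apply: (subset_measure0 (mB k) mA _ A0) => x [].
by rewrite mule0.
Qed.

Lemma density_bound_ae mu nu J (P : T -> Prop) : measurable_fun setT J ->
  density_bound mu nu J -> (\forall x \ae mu, P x) -> \forall x \ae nu, P x.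
Proof.
move=> mJ numu [A [mA A0 PA]]; exists A; split => //.
exact: density_bound_null numu mA A0.
Qed.

(** The norm for the exponent +oo is 0 by convention when the whole space is
    null; then every property holds almost everywhere. *)
Lemma Lnorm_pinfty_ae mu (f : T -> \bar R) :
  \forall x \ae mu, `|f x| <= Lnorm mu +oo f.
Proof.
rewrite unlock; case: ifPn => [_|mu0]; first exact: ess_sup_ge.
exists setT; split => //; apply/eqP; rewrite -measure_le0.
by rewrite leNgt.
Qed.

Lemma Lnorm_pinfty_le mu (f : T -> \bar R) (y : \bar R) : 0 <= y ->
  (\forall x \ae mu, `|f x| <= y) -> Lnorm mu +oo f <= y.
Proof.
by move=> y0 fy; rewrite unlock; case: ifPn => // _; apply/ess_supP.
Qed.

Lemma density_bound_Lnorm_pinfty mu nu J (f : T -> \bar R) :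
  measurable_fun setT J -> density_bound mu nu J ->
  Lnorm nu +oo f <= Lnorm mu +oo f.
Proof.
move=> mJ numu; apply: Lnorm_pinfty_le; first exact: Lnorm_ge0.
exact: (density_bound_ae mJ numu (Lnorm_pinfty_ae mu f)).
Qed.

Lemma ae_eq0_Lnorm nu (r : R) (f : T -> \bar R) : (0 < r)%R ->
  measurable_fun setT f -> (\forall x \ae nu, f x = 0) -> Lnorm nu r%:E f = 0.
Proof.
move=> r0 mf f0; rewrite unlock (ae_eq_integral (cst 0))//.
- by rewrite integral_cst// mul0e poweR0r// invr_neq0// gt_eqF.
- apply: (measurableT_comp (measurable_poweR _)).
  exact: measurableT_comp.
- by apply: filterS f0 => x fx _; rewrite fx abse0 poweR0r// gt_eqF.
Qed.

(** The bound on [J] holds only almost everywhere on [S], whereas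
    [density_bound] needs it everywhere: [g] is cut off to the part [E] of [S]
    where the bound holds. The cut-off does not change the [nu]-integral because
    [nu] is absolutely continuous, and it can only decrease the
    [mu]-integral. *)
Lemma density_bound_integral mu nu J (S : set T) (g : T -> \bar R) (b : R) :
  measurable_fun setT J -> density_bound mu nu J ->
  measurable S -> (0 <= b)%R -> (\forall x \ae mu, S x -> (J x <= b)%R) ->
  measurable_fun setT g -> (forall x, 0 <= g x) ->
  (forall x, ~ S x -> g x = 0) ->
  \int[nu]_x g x <= b%:E * \int[mu]_x g x.
Proof.
move=> mJ numu mS b0 Jb mg g0 gS.
pose E := S `&` (J @^-1` `]-oo, b]%classic).
have mE : measurable E.
  by apply: measurableI => //; rewrite -[X in measurable X]setTI; exact: mJ.
have EJ x : E x -> (J x <= b)%R by case=> _; rewrite /= in_itv.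
have mgE : measurable_fun setT (g \_ E).
  by apply/(measurable_restrictT _ _).1 => //; exact: measurable_funTS.
have gE0 x : 0 <= (g \_ E) x by rewrite patchE; case: ifPn.
have -> : \int[nu]_x g x = \int[nu]_x (g \_ E) x.
  apply: ae_eq_integral => //.
  apply: filterS (density_bound_ae mJ numu Jb) => x SJ _.
  rewrite patchE; case: ifPn => //; rewrite notin_setE => Ex.
  apply: gS => Sx; apply: Ex; split => //=.
  by rewrite in_itv/= SJ.
apply: (@le_trans _ _ (\int[mscale (NngNum b0) mu]_x (g \_ E) x)).
  apply: (@ge0_le_measure_integral_on _ _ E) => //.
    by move=> A mA AE; apply: numu => // x /AE/EJ.
  by move=> x Ex; rewrite patchE memNset.
rewrite ge0_integral_mscale//=; apply: lee_wpmul2l; first by rewrite lee_fin.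
apply: ge0_le_integral => // x _.
by rewrite patchE; case: ifPn.
Qed.

(** With K the weighted essential supremum on the right: if K is infinite, the
    right-hand side is infinite unless [f] vanishes [mu]-almost everywhere, hence
    [nu]-almost everywhere. If K is finite then [J <= K `^ p] almost everywhere on
    [S], and the bound on the integrals is raised to the power [1 / p]. For
    p = +oo the weight is the indicator of [S], by which [f] may be multiplied
    for free. *)
Lemma density_bound_Lnorm mu nu J (S : set T) (f : T -> \bar R) (p : \bar R) :
  measurable_fun setT J -> (forall x, (0 <= J x)%R) -> density_bound mu nu J ->
  measurable S -> measurable_fun setT f -> (forall x, ~ S x -> f x = 0) ->
  1 <= p ->
  Lnorm nu p f <=
  Lnorm mu +oo (EFin \o (fun x => \1_S x * J x `^ (fine p^-1%E))%R) *
  Lnorm mu p f.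
Proof.
move=> mJ J0 numu mS mf fS p1.
set w := EFin \o _; set K := Lnorm mu +oo w.
have K0 : 0 <= K by exact: Lnorm_ge0.
have wK : \forall x \ae mu, `|w x| <= K := Lnorm_pinfty_ae _ _.
case: p p1 @w @K K0 wK => [r| |//].
  rewrite lee_fin => r1; have r0 : (0 < r)%R := lt_le_trans ltr01 r1.
  have rV0 : (0 <= r^-1)%R by rewrite invr_ge0 ltW.
  have -> : (r%:E)^-1 = (r^-1)%:E.
    by rewrite /inve gt_eqF.
  rewrite /=; set w := EFin \o _; set K := Lnorm mu +oo w => K0 wK.
  have mfr : measurable_fun setT (fun x => `|f x| `^ r).
    apply: (measurableT_comp (measurable_poweR _)).
    exact: measurableT_comp.
  have [f0|fN0] := eqVneq (Lnorm mu r%:E f) 0.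
    rewrite f0 mule0 ae_eq0_Lnorm//.
    apply: (density_bound_ae mJ numu).
    have := Lnorm_eq0_eq0 mf _ f0; rewrite lte_fin => /(_ r0).
    by apply: filterS => x /(_ I).
  have [Koo|Kfin] := eqVneq K +oo.
    by rewrite Koo gt0_mulye ?leey// lt0e fN0 Lnorm_ge0.
  have [k Kk k0] : exists2 k, K = k%:E & (0 <= k)%R.
    by case: K K0 Kfin {wK} => // k k0 _; exists k.
  rewrite Kk in wK *.
  have Jb : \forall x \ae mu, S x -> (J x <= k `^ r)%R.
    apply: filterS wK => x; rewrite /w /= => + Sx.
    rewrite indicE mem_set// mul1r lee_fin ger0_norm ?powR_ge0// => Jk.
    rewrite -[leLHS]powRr1// -(mulVf (lt0r_neq0 r0)) powRrM.
    by apply: ge0_ler_powR; rewrite ?nnegrE ?powR_ge0// ltW.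
  have fr0 x : 0 <= `|f x| `^ r by exact: poweR_ge0.
  have frS x : ~ S x -> `|f x| `^ r = 0.
    by move=> /fS ->; rewrite abse0 poweR0r// gt_eqF.
  have int := density_bound_integral mJ numu mS (powR_ge0 k r) Jb mfr fr0 frS.
  rewrite unlock.
  have I0 (m : {measure set T -> \bar R}) : 0 <= \int[m]_x `|f x| `^ r.
    by apply: integral_ge0 => x _; exact: fr0.
  apply: le_trans (gt0_ler_poweR _ _ _ int) _ => //.
  - by rewrite in_itv/= leey andbT.
  - by rewrite in_itv/= leey andbT mule_ge0// lee_fin powR_ge0.
  rewrite poweRM ?lee_fin ?powR_ge0// poweR_EFin.
  by rewrite -powRrM mulfV ?powRr1// gt_eqF.
move=> _; rewrite /=; set w := EFin \o _; set K := Lnorm mu +oo w => K0 wK.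
apply: Lnorm_pinfty_le; first by rewrite mule_ge0// Lnorm_ge0.
apply: (density_bound_ae mJ numu).
apply: filterS2 wK (Lnorm_pinfty_ae mu f) => x; rewrite /w /= => wK fK.
have [Sx|Sx] := pselect (S x); last by rewrite fS// abse0 mule_ge0// Lnorm_ge0.
rewrite -[leLHS]mul1e; apply: lee_pmul => //.
apply: le_trans wK; rewrite indicE mem_set// mul1r.
by rewrite powRr0 normr1.
Qed.

End Measures.

Lemma Lnorm_pushforward d d' (X : measurableType d) (Y : measurableType d')
    (R : realType) (h : X -> Y) (mh : measurable_fun setT h)
    (m : {measure set X -> \bar R}) (f : Y -> \bar R) (p : \bar R) :
  measurable_fun setT f -> (1 <= p)%E ->
  Lnorm (image_measure m mh) p f = Lnorm m p (f \o h).
Proof.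
move=> mf; rewrite unlock; case: p => [r| |//] r1.
  rewrite ge0_integral_pushforward//; last by move=> y _; exact: poweR_ge0.
  by apply: (measurableT_comp (measurable_poweR _)); exact: measurableT_comp.
have mfh : measurable_fun setT (f \o h) by exact: measurableT_comp.
rewrite !ess_supEmu0//; exact: measurableT_comp.
Qed.

(** * Charts transported by a diffeomorphism *)

Lemma diff_near_id (R : numFieldType) (V : normedModType R) (f : V -> V)
    (x : V) :
  (\forall y \near x, f y = y) -> 'd f x = id :> (V -> V).
Proof.
move=> fid.
have -> : id = (idfun : {linear V -> V}) :> (V -> V) by [].
apply: diff_unique; first by move=> y; exact: cvg_id.
apply/eqaddoP => _/posnumP[e].
have : \forall h \near (0 : V), f (h + x) = h + x.
  rewrite (near_shift x); apply: filterS fid => y fy.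
  by rewrite /= sub0r subrK.
apply: filterS => h fh.
rewrite -[X in `|X|]/(f (h + x) - (f x + h)) fh (nbhs_singleton fid).
by rewrite [x + h]addrC subrr normr0 mulr_ge0.
Qed.

Lemma det_jacobian_near_id (R : realType) n (f : 'rV[R]_n -> 'rV[R]_n)
    (x : 'rV[R]_n) :
  (\forall y \near x, f y = y) -> \det ('J f x) = 1.
Proof.
move=> /diff_near_id fid; rewrite /jacobian.
suff -> : lin1_mx ('d f x) = 1%:M by rewrite det1.
by apply/matrixP => i j; rewrite !mxE fid !mxE eqxx eq_sym.
Qed.

Section Transport.
Context (R : realType) (n : nat) (M N : smooth_manifold R n).
Variables (phi : M -> N) (psi : N -> M).
Hypothesis hphi : diffeomorphism phi psi.

Let phiK : cancel phi psi. Proof. by case: hphi. Qed.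
Let psiK : cancel psi phi. Proof. by case: hphi. Qed.
Let phic : continuous phi. Proof. by case: hphi => -[]. Qed.
Let psic : continuous psi. Proof. by case: hphi => _ []. Qed.

Definition transport_chart (c : chart R n M) : chart R n N.
Proof.
refine (@Chart R n N (psi @^-1` chart_dom c) (chart_cod c) (c \o psi)
  (phi \o chart_inv c) _ (chart_cod_open c) _ _ _ _ _ _).
- by apply: open_comp; [move=> x _; exact: psic|exact: chart_dom_open].
- by move=> q; exact: chart_map_cod.
- by move=> y cy; rewrite /preimage /= phiK; exact: chart_inv_dom.
- by move=> q cq /=; rewrite chart_mapK.
- by move=> y cy /=; rewrite phiK chart_invK.
- move=> q cq; apply: continuous_comp; first exact: psic.
  exact: chart_map_continuous.
- move=> y cy; apply: continuous_comp; first exact: chart_inv_continuous.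
  exact: phic.
Defined.

(** The transition maps between [c \o psi] and a chart of [N] are exactly the
    local expressions of [phi] and [psi], hence smooth; the atlas is maximal. *)
Lemma atlas_transport_chart (c : chart R n M) : atlas c -> atlas (transport_chart c).
Proof.
move=> ac; apply: atlas_maximal => d ad.
by case: hphi => -[_ sphi] [_ spsi] _ _; split; [exact: sphi|exact: spsi].
Qed.

Lemma chart_det_transport (c : chart R n M) (p : M) : chart_dom c p ->
  chart_det phi c (transport_chart c) p = 1.
Proof.
move=> cp; apply: det_jacobian_near_id.
have : nbhs (c p) (chart_cod c).
  by apply: open_nbhs_nbhs; split; [exact: chart_cod_open|exact: chart_map_cod].
by apply: filterS => y cy /=; rewrite phiK chart_invK.
Qed.

(** The local expression [c \o psi \o (phi \o chart_inv c)] is, up to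
    associativity, also that of [phi] read in the same two charts. *)
Lemma chart_det_transport_inv (c : chart R n M) (q : N) :
  chart_dom c (psi q) -> chart_det psi (transport_chart c) c q = 1.
Proof.
move=> cq; rewrite -(chart_det_transport cq) /chart_det /=.
by congr (\det ('J _ _)).
Qed.

(** A set and its transport have the same image in R^n under [c] and
    [transport_chart c], so the two integrals differ only by their
    integrands. *)
Lemma chart_volume_transport (wM : top_form M) (wN : top_form N)
    (J : M -> R) (b : R) (c : chart R n M) (A : set (borel M)) :
  atlas c -> measurable A -> A `<=` chart_dom c -> 0 <= b ->
  (forall p, A p -> `|wN (transport_chart c) (phi p)| = J p * `|wM c p|) ->
  (forall p, A p -> J p <= b) ->
  (chart_volume wN (transport_chart c) (psi @^-1` A) <=
   b%:E * chart_volume wM c A)%E.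
Proof.
move=> ac mA Ac b0 wJ Jb; rewrite /chart_volume.
have -> : transport_chart c @` (psi @^-1` A) = c @` A.
  apply/seteqP; split => [_ [q Aq <-]|_ [p Ap <-]]; first by exists (psi q).
  by exists (phi p); rewrite /= phiK.
have mcA := measurable_chart_image mA Ac.
have cAc : c @` A `<=` chart_cod c.
  by move=> _ [p /Ac cp <-]; exact: chart_map_cod.
have mcod := open_borel (chart_cod_open c).
have mwM := measurable_funS mcod cAc (measurable_chart_density wM ac).
rewrite -ge0_integralZl_EFin//.
apply: ge0_le_integral => //.
- apply: measurable_funS mcod cAc _.
  exact: measurable_chart_density (atlas_transport_chart ac).
- exact: measurable_funeM.
- move=> _ [p Ap <-] /=; rewrite chart_mapK; last exact: Ac.
  by rewrite -EFinM lee_fin wJ// ler_wpM2r// Jb.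
Qed.

(** Every cover of [A] by sets contained in charts of [M] is transported, after
    intersecting it with [A], to a cover of its preimage by sets contained in
    charts of [N], and each term of the sum grows by a factor at most [b]. *)
Lemma volume_transport (wM : top_form M) (wN : top_form N)
    (J : M -> R) (b : R) (A : set (borel M)) :
  (forall c p, atlas c -> chart_dom c p ->
     `|wN (transport_chart c) (phi p)| = J p * `|wM c p|) ->
  (forall p, 0 < J p) ->
  measurable A -> 0 <= b -> (forall p, A p -> J p <= b) ->
  (volume wN (psi @^-1` A) <= b%:E * volume wM A)%E.
Proof.
move=> wJ J0 mA b0 Jb.
have mpsi : measurable_fun setT (psi : borel N -> borel M).
  apply: continuous_borel_fun; first exact: openT.
  by move=> x _; exact: psic.
have [b_eq0|bN0] := eqVneq b 0.
  (* Scaling by 0 does not commute with the infimum of the empty family, which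
     is the local volume of a set contained in no chart; but here J > 0 forces A
     to be empty. *)
  suff -> : A = set0 by rewrite preimage_set0 measure0 mule_ge0.
  by apply/seteqP; split=> // p /Jb; rewrite b_eq0 leNgt J0.
have bgt0 : 0 < b by rewrite lt_def bN0.
rewrite -ereal_inf_pZl//; apply: le_ereal_inf_tmp => _ [_ [F [mF AF] <-] <-].
rewrite -nneseriesZl; last by move=> *; exact: local_volume_ge0.
pose G k : set (borel N) := psi @^-1` (A `&` F k).
have mAF k : measurable (A `&` F k) by exact: measurableI.
apply: (@le_trans _ _ (\sum_(k <oo) local_volume wN (G k))%E).
  apply: ereal_inf_lbound; exists G => //; split=> [k|].
    by rewrite -[X in measurable X]setTI; exact: mpsi.
  by move=> q Aq; have [k _ Fk] := AF _ Aq; exists k.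
apply: lee_nneseries => [k *|k _]; first exact: local_volume_ge0.
rewrite -ereal_inf_pZl//; apply: le_ereal_inf_tmp => _ [_ [c [ac Fc] <-] <-].
apply: (@le_trans _ _ (chart_volume wN (transport_chart c) (G k))).
  apply: ereal_inf_lbound; exists (transport_chart c) => //; split.
    exact: atlas_transport_chart.
  by move=> q [_ /Fc].
apply: le_trans (chart_volume_transport ac (mAF k) _ b0 _ _) _.
- by move=> p [_ /Fc].
- by move=> p [_ /Fc]; exact: wJ.
- by move=> p [/Jb].
apply: lee_wpmul2l; first by rewrite lee_fin.
apply: ge0_subset_integral => //.
- by apply: measurable_chart_image => // p [_ /Fc].
- exact: measurable_chart_image.
- apply: measurable_funS (measurable_chart_density wM ac).
    exact: open_borel (chart_cod_open c).
  by move=> _ [p /Fc cp <-]; exact: chart_map_cod.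
- by move=> _ [p [_ Fp] <-]; exists p.
Qed.

End Transport.

(** * Measurability on a manifold *)

Section Manifold.
Context (R : realType) (n : nat) (M : smooth_manifold R n).

Lemma smooth_fun_continuous (u : M -> R) : smooth_fun u -> continuous u.
Proof.
move=> su p; have [c ac cp] := atlas_cover p.
have [uc _] := su c ac 0%N.
have cuc : {for p, continuous (u \o chart_inv c \o c)}.
  apply: continuous_comp; first exact: chart_map_continuous.
  by apply: uc; exact: chart_map_cod.
have ucu : {near p, u \o chart_inv c \o c =1 u}.
  have : nbhs p (chart_dom c).
    by apply: open_nbhs_nbhs; split => //; exact: chart_dom_open.
  by apply: filterS => q cq; rewrite /= chart_mapK.
apply: cvg_trans (near_eq_cvg ucu) _.
by rewrite -[u p](nbhs_singleton ucu); exact: cuc.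
Qed.

Lemma measurable_smooth_fun (u : M -> R) : smooth_fun u ->
  measurable_fun setT (u : borel M -> R).
Proof.
move=> su; apply: continuous_borel_real; first exact: openT.
by move=> x _; exact: smooth_fun_continuous.
Qed.

Lemma measurable_supp (u : M -> R) : measurable (supp u : set (borel M)).
Proof.
rewrite -[supp u]setCK; apply: measurableC; apply: open_borel.
by apply: closed_openC; exact: closed_closure.
Qed.

End Manifold.

(** * Comparison of the two volumes *)

Lemma diffeomorphism_sym (R : realType) n (M N : smooth_manifold R n)
    (phi : M -> N) (psi : N -> M) :
  diffeomorphism phi psi -> diffeomorphism psi phi.
Proof. by case. Qed.

(** In a chart and its transport the determinant is 1, so [phi] matches their
    signs of orientation and the coefficients of the two forms, whose ratio is
    [J], have the same sign. *)
Lemma jacobian_gt0 (R : realType) (n : nat) (M N : smooth_manifold R n)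
    (oM : orientation M) (oN : orientation N)
    (muM : top_form M) (muN : top_form N) (phi : M -> N) (psi : N -> M)
    (J : M -> R) :
  is_volume_form oM muM -> is_volume_form oN muN ->
  diffeomorphism phi psi -> orientation_preserving oM oN phi ->
  is_jacobian_determinant muM muN phi J ->
  forall p, 0 < J p.
Proof.
move=> hM hN hphi hor [_ hJ] p.
have phiK : psi (phi p) = p by case: hphi => _ _ ->.
have [c ac cp] := atlas_cover p.
pose d := transport_chart hphi c.
have ad : atlas d by exact: atlas_transport_chart.
have dp : chart_dom d (phi p) by rewrite /= /preimage/= phiK.
have := hJ c d p ac ad cp dp; rewrite chart_det_transport// mulr1.
have := hor c d p ac ad cp dp; rewrite chart_det_transport// ltr01 eqb_id => oNM.
have := hN d _ ad dp; rewrite oNM; have := hM c p ac cp.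
case: ifPn => _ wM wN JE; move: wN; rewrite JE.
  by rewrite pmulr_lgt0.
by rewrite nmulr_llt0.
Qed.

Section Comparison.
Context (R : realType) (n : nat) (M N : smooth_manifold R n).
Variables (muM : top_form M) (muN : top_form N).
Variables (phi : M -> N) (psi : N -> M) (J : M -> R).
Hypothesis hphi : diffeomorphism phi psi.
Hypothesis hJ : is_jacobian_determinant muM muN phi J.
Hypothesis J0 : forall p, 0 < J p.
Hypothesis mpsi : measurable_fun setT (psi : borel N -> borel M).

Let phiK : cancel phi psi. Proof. by case: hphi. Qed.
Let psiK : cancel psi phi. Proof. by case: hphi. Qed.

Let volM : {measure set (borel M) -> \bar R} := volume muM.
Let volN : {measure set (borel M) -> \bar R} :=
  image_measure (volume muN : {measure set (borel N) -> \bar R}) mpsi.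

Lemma density_bound_volume : density_bound volM volN J.
Proof.
move=> A b mA b0 Jb.
have wJ c p : atlas c -> chart_dom c p ->
    `|muN (transport_chart hphi c) (phi p)| = J p * `|muM c p|.
  move=> ac cp; have dp : chart_dom (transport_chart hphi c) (phi p).
    by rewrite /= /preimage/= phiK.
  have := hJ.2 c _ p ac (atlas_transport_chart hphi ac) cp dp.
  by rewrite chart_det_transport// mulr1 => ->; rewrite normrM gtr0_norm.
exact: (volume_transport wJ J0 mA b0 Jb).
Qed.

Lemma density_bound_volume_inv : density_bound volN volM (fun p => (J p)^-1).
Proof.
move=> A b mA b0 Jb.
have hpsi := diffeomorphism_sym hphi.
have AE : phi @^-1` (psi @^-1` A) = A.
  by apply/seteqP; split => p; rewrite /preimage/= phiK.
have mpA : measurable (psi @^-1` A : set (borel N)).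
  by rewrite -[X in measurable X]setTI; exact: mpsi.
have wJ d q : atlas d -> chart_dom d q ->
    `|muM (transport_chart hpsi d) (psi q)| = (J (psi q))^-1 * `|muN d q|.
  move=> ad dq; set c := transport_chart hpsi d.
  have cp : chart_dom c (psi q) by rewrite /= /preimage/= psiK.
  have dq' : chart_dom d (phi (psi q)) by rewrite psiK.
  have := hJ.2 c d _ (atlas_transport_chart hpsi ad) ad cp dq'.
  rewrite chart_det_transport_inv// mulr1 psiK => ->.
  by rewrite normrM (gtr0_norm (J0 _)) mulKf// gt_eqF.
have JV0 q : 0 < (J (psi q))^-1 by rewrite invr_gt0.
have := volume_transport wJ JV0 mpA b0 (fun q => Jb (psi q)).
by rewrite AE.
Qed.

End Comparison.

(** * The estimates *)

(** The reading of the left factor in the degenerate cases: the inverse of 0 is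
    +oo, but then [x = 0] and the product is 0; the inverse of +oo is 0. *)
Lemma lee_inve_mul (R : realType) (k x y : \bar R) :
  (0 <= k -> 0 <= x -> 0 <= y -> x <= k * y -> k^-1 * x <= y)%E.
Proof.
case: k => [k| |//].
  rewrite lee_fin le_eqVlt => /predU1P[<- x0 y0|k0 x0 y0 xky].
    rewrite mul0e => x_le0.
    have -> : x = 0%E by apply/eqP; rewrite eq_le x_le0.
    by rewrite mule0.
  have -> : (k%:E^-1 = (k^-1)%:E)%E by rewrite /inve gt_eqF.
  by rewrite lee_pdivrMl.
by move=> _ x0 y0 _; rewrite [(+oo^-1)%E]/inve mul0e.
Qed.

Theorem theorem1 (R : realType) (n : nat) (M N : smooth_manifold R n)
    (oM : orientation M) (oN : orientation N)
    (muM : top_form M) (muN : top_form N)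
    (hmuM : is_volume_form oM muM) (hmuN : is_volume_form oN muN)
    (phi : M -> N) (phi_inv : N -> M)
    (hphi : diffeomorphism phi phi_inv)
    (hor : orientation_preserving oM oN phi)
    (J : M -> R) (hJ : is_jacobian_determinant muM muN phi J)
    (u : M -> R) (hu : smooth_fun u) (hsupp : compact (supp u))
    (p : \bar R) (hp : (1%:E <= p)%E) :
  ((Lp_norm muM +oo (fun x => \1_(supp u) x * J x `^ (- fine p^-1%E))%R)^-1
     * Lp_norm muM p u
   <= Lp_norm muN p (u \o phi_inv))%E
  /\
  (Lp_norm muN p (u \o phi_inv)
   <= Lp_norm muM +oo (fun x => \1_(supp u) x * J x `^ (fine p^-1%E))%R
        * Lp_norm muM p u)%E.
Proof.
have J0 := jacobian_gt0 hmuM hmuN hphi hor hJ.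
have mpsi : measurable_fun setT (phi_inv : borel N -> borel M).
  apply: continuous_borel_fun; first exact: openT.
  by case: hphi => _ [cpsi _] _ _ x _; exact: cpsi.
pose volN := image_measure (volume muN : {measure set (borel N) -> \bar R}) mpsi.
have mJ := measurable_smooth_fun hJ.1.
have mJV : measurable_fun setT (fun x : borel M => (J x)^-1).
  apply: continuous_borel_real; first exact: openT.
  move=> x _; apply: continuousV; first by rewrite gt_eqF.
  exact: smooth_fun_continuous hJ.1 _.
have mu : measurable_fun setT (EFin \o u : borel M -> \bar R).
  by apply/measurable_EFinP; exact: measurable_smooth_fun.
have mS := measurable_supp u.
have uS x : ~ supp u x -> (EFin \o u) x = 0%E.
  move=> Sx; congr EFin; apply: contrapT => /eqP ux; apply: Sx.
  exact: subset_closure.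
have bMN := density_bound_volume hphi hJ J0 mpsi.
have bNM := density_bound_volume_inv hphi hJ J0 mpsi.
have uN : Lp_norm muN p (u \o phi_inv) = Lnorm volN p (EFin \o u).
  by rewrite /Lp_norm Lnorm_pushforward.
rewrite uN; split; last first.
  by apply: density_bound_Lnorm bMN _ _ _ _ => // x; exact: ltW.
apply: lee_inve_mul; [exact: Lnorm_ge0..|].
(* The essential supremum comes out for the pulled-back measure of muN; it is at
   most the one for muM, by absolute continuity. *)
apply: le_trans (density_bound_Lnorm mJV _ bNM mS mu uS hp) _.
  by move=> x; rewrite invr_ge0 ltW.
apply: lee_wpmul2r; first exact: Lnorm_ge0.
apply: le_trans (density_bound_Lnorm_pinfty _ mJ bMN) _.
rewrite le_eqVlt; apply/orP; left; apply/eqP; congr Lnorm.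
apply/funext => x /=; congr (_ * _)%:E.
by rewrite -powR_inv1 ?ltW// -powRrM mulN1r.
Qed.
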